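(* Let $g$ be a discrete holomorphic function with $|g|\neq 1$ at all vertices, and for each admissible $\lambda$ let $\hat n=\hat n^{\lambda}$ be the discrete CMC $1$ surface in $\mathbb{S}^{2,1}$ with Weierstrass-type representation determined by $g$ and $\lambda$ as in the context. Fix a quadrilateral with vertices $i,j,k,\ell$, and let $C$ be the circumcircle of $g_i,g_j,g_k,g_\ell$ in $\mathbb{C}$. If $C$ intersects the unit circle $\mathbb{S}^1\subset\mathbb{C}$ transversally, then the quadrilateral of $\hat n$ is singular for all $\lambda$ sufficiently close to zero. Conversely, under the generic assumption that $\partial_\lambda\mathcal{H}\ne0$ at $\lambda=0$, if the quadrilateral of $\hat n$ is singular for all $\lambda$ sufficiently close to zero, then $C$ intersects $\mathbb{S}^1$ transversally. Here $\mathcal{H}=h_1^2+h_2^2+h_3^2-(h_2-h_1)^2-(h_3-h_1)^2-(h_3-h_2)^2$ with $$h_1=(1-|g_j|^2)|dg_{i\ell}|^2(1-\lambda\alpha_{ij}),\quad h_2=(1-|g_\ell|^2)|dg_{ij}|^2(1-\lambda\alpha_{i\ell}),\quad h_3=(1-|g_i|^2)|dg_{j\ell}|^2.$$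
   Context: Minkowski space $\mathbb{R}^{3,1}$ (signature $(-,+,+,+)$) is identified with Hermitian $2\times 2$ matrices via $(x_0,x_1,x_2,x_3)\mapsto X=\begin{pmatrix} x_0+x_3 & x_1-ix_2\\ x_1+ix_2 & x_0-x_3\end{pmatrix}$, so $\langle X,X\rangle=-\det X$. $\mathbb{S}^{2,1}=\{\langle X,X\rangle=1\}$. A quadrilateral of $\mathbb{Z}^2$ has vertices $i=(m,n)$, $j=(m+1,n)$, $k=(m+1,n+1)$, $\ell=(m,n+1)$. For a function $u$ on vertices, $du_{ab}=u_b-u_a$. A discrete holomorphic function is $g:\mathbb{Z}^2\to\mathbb{C}$ with $\frac{(g_i-g_j)(g_k-g_\ell)}{(g_j-g_k)(g_\ell-g_i)}=\frac{\alpha_{ij}}{\alpha_{i\ell}}<0$ on all quadrilaterals, where the real-valued cross ratio factorizing function $\alpha$ on edges satisfies $\alpha_{ij}=\alpha_{\ell k}$, $\alpha_{i\ell}=\alpha_{jk}$; it is assumed that $dg\ne0$ on all edges. Discrete CMC $1$ surface in $\mathbb{S}^{2,1}$ with Weierstrass-type representation (the case $t=-1$ of the general representation): set $\mathcal{T}_i=1-|g_i|^2\ne0$. A real $\lambda\neq0$ is admissible if $1-\lambda\alpha\ne0$ on all edges. Let $E:\mathbb{Z}^2\to\mathrm{SL}_2\mathbb{C}$ solve $E_i^{-1}E_*=\frac{1}{\sqrt{1-\lambda\alpha_{i*}}}\begin{pmatrix}1&dg_{i*}\\ \lambda\alpha_{i*}/dg_{i*}&1\end{pmatrix}$, $*=j,\ell$,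 let $L_i=\begin{pmatrix}0&\sqrt{\mathcal{T}_i}\\ -1/\sqrt{\mathcal{T}_i}&\bar g_i/\sqrt{\mathcal{T}_i}\end{pmatrix}$, and $\hat n_i=\mathrm{sgn}(\mathcal{T}_i)E_iL_i\begin{pmatrix}1&0\\0&-1\end{pmatrix}\overline{E_iL_i}^{t}$. A quadrilateral of $\hat n$ is singular if it does not lie in a spacelike plane of $\mathbb{R}^{3,1}$, i.e. if $\langle d\hat n_{ij},d\hat n_{ij}\rangle\langle d\hat n_{i\ell},d\hat n_{i\ell}\rangle-\langle d\hat n_{ij},d\hat n_{i\ell}\rangle^2\le0$. ''For all $\lambda$ sufficiently close to zero'' means: there is $\varepsilon>0$ such that the property holds for all admissible $\lambda$ with $0<|\lambda|<\varepsilon$. *)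

(* Defs.v *)
From mathcomp Require Import all_boot all_order all_algebra.
From mathcomp Require Import complex.
From mathcomp Require Import ring.
From mathcomp Require Import all_classical all_reals all_analysis.

Set Implicit Arguments.
Unset Strict Implicit.
Unset Printing Implicit Defensive.

Import Order.TTheory GRing.Theory Num.Theory.
Import numFieldNormedType.Exports.
Import ComplexField.Normc.

Local Open Scope ring_scope.
Local Open Scope complex_scope.

(* The square lattice.  For the quadrilateral with first vertex i, the
   vertices are i, vj i, vk i, vl i in cyclic order. *)
Definition vertex := (int * int)%type.
Definition vj (i : vertex) : vertex := (i.1 + 1, i.2).
Definition vk (i : vertex) : vertex := (i.1 + 1, i.2 + 1).
Definition vl (i : vertex) : vertex := (i.1, i.2 + 1).

(* Edges are written from the smaller to the larger vertex, i.e. as pairs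
   (i, vj i) and (i, vl i).  An edge function alpha : vertex -> vertex -> R is
   only ever evaluated at such pairs; its other values are irrelevant. *)
Definition diff (V : zmodType) (u : vertex -> V) (a b : vertex) : V := u b - u a.

Section Complex.
Variable R : realType.

Definition mx2 (a b c d : R[i]) : 'M[R[i]]_2 :=
  \matrix_(p, q) if p == 0 then (if q == 0 then a else b)
                 else (if q == 0 then c else d).

Definition ctrmx (A : 'M[R[i]]_2) : 'M[R[i]]_2 := (map_mx conjc A)^T.

(* Minkowski space: coordinates 0..3 of 'rV_4, coordinate 0 being timelike. *)
Definition c0 : 'I_4 := @Ordinal 4 0 isT.
Definition c1 : 'I_4 := @Ordinal 4 1 isT.
Definition c2 : 'I_4 := @Ordinal 4 2 isT.
Definition c3 : 'I_4 := @Ordinal 4 3 isT.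

Definition mink (x y : 'rV[R]_4) : R :=
  - (x 0 c0 * y 0 c0) + x 0 c1 * y 0 c1 + x 0 c2 * y 0 c2 + x 0 c3 * y 0 c3.

Definition to_herm (x : 'rV[R]_4) : 'M[R[i]]_2 :=
  mx2 ((x 0 c0 + x 0 c3)%:C) (x 0 c1 -i* x 0 c2)
      (x 0 c1 +i* x 0 c2) ((x 0 c0 - x 0 c3)%:C).

(* Inverse of to_herm on Hermitian matrices, see of_hermK. *)
Definition of_herm (X : 'M[R[i]]_2) : 'rV[R]_4 :=
  \row_q nth 0 [:: (complex.Re (X 0 0) + complex.Re (X 1 1)) / 2;
                   complex.Re (X 1 0); complex.Im (X 1 0);
                   (complex.Re (X 0 0) - complex.Re (X 1 1)) / 2] q.

Lemma to_hermK (x : 'rV[R]_4) : of_herm (to_herm x) = x.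
Proof.
apply/rowP => q; rewrite !mxE /=.
case: q => -[|[|[|[|//]]]] lt_q /=.
- by transitivity (x 0 c0); [field | congr (x _ _); apply/val_inj].
- by congr (x _ _); apply/val_inj.
- by congr (x _ _); apply/val_inj.
- by transitivity (x 0 c3); [field | congr (x _ _); apply/val_inj].
Qed.

Lemma of_hermK (X : 'M[R[i]]_2) : ctrmx X = X -> to_herm (of_herm X) = X.
Proof.
move=> hX; have E p q : (X q p)^* = X p q by rewrite -[in RHS]hX !mxE.
have Im0 p : complex.Im (X p p) = 0.
  by move: (E p p); case: (X p p) => a b [] /eqP; rewrite eqNr => /eqP.
have h0 := Im0 0; have h1 := Im0 1; have E01 := E 0 1.
apply/matrixP.
have ord2 (p : 'I_2) : p = 0 \/ p = 1.
  by case: p => -[|[|//]] lp; [left|right]; apply/val_inj.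
move=> p q; case: (ord2 p) => ->; case: (ord2 q) => ->; rewrite !mxE /=.
- by case: (X 0 0) h0 => a b /= ->; congr (_ +i* _); field.
- by rewrite -E01; case: (X 1 0).
- by case: (X 1 0).
- by case: (X 1 1) h1 => a b /= ->; congr (_ +i* _); field.
Qed.

Lemma mink_det (x : 'rV[R]_4) : (mink x x)%:C = - \det (to_herm x).
Proof.
rewrite (expand_det_row _ 0) !big_ord_recl big_ord0 /cofactor !det_mx11 !mxE /=.
rewrite /mink expr0 expr1; simpc.
by apply/eqP; rewrite eq_complex /=; apply/andP; split; apply/eqP; ring.
Qed.

(* Circles and lines of the complex plane: four points with real cross ratio
   may be collinear, in which case their "circumcircle" is a line. *)
Inductive gcircle := Circle of R[i] & R | Line of R[i] & R[i].

Definition gcircle_wf (C : gcircle) : Prop :=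
  match C with Circle c r => 0 < r | Line p v => v != 0 end.

Definition on_gcircle (C : gcircle) (z : R[i]) : Prop :=
  match C with
  | Circle c r => normc (z - c) = r
  | Line p v => exists t : R, z = p + t%:C * v
  end.

Definition tangent_dir (C : gcircle) (z : R[i]) : R[i] :=
  match C with Circle c r => 'i * (z - c) | Line p v => v end.

Definition real_indep (v w : R[i]) : Prop :=
  forall a b : R, a%:C * v + b%:C * w = 0 -> a = 0 /\ b = 0.

Definition intersect_transversally (C D : gcircle) : Prop :=
  (exists z, on_gcircle C z /\ on_gcircle D z) /\
  (forall z, on_gcircle C z -> on_gcircle D z ->
     real_indep (tangent_dir C z) (tangent_dir D z)).

Definition unit_circle : gcircle := Circle 0 1.

Definition is_circumcircle (C : gcircle) (g : vertex -> R[i]) (i : vertex) :=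
  [/\ gcircle_wf C, on_gcircle C (g i), on_gcircle C (g (vj i)),
      on_gcircle C (g (vk i)) & on_gcircle C (g (vl i))].

Definition cross_ratio_factorizing (alpha : vertex -> vertex -> R) : Prop :=
  forall i, alpha i (vj i) = alpha (vl i) (vk i) /\
            alpha i (vl i) = alpha (vj i) (vk i).

Definition discrete_holomorphic (g : vertex -> R[i])
    (alpha : vertex -> vertex -> R) : Prop :=
  [/\ cross_ratio_factorizing alpha,
      forall i, diff g i (vj i) != 0 /\ diff g i (vl i) != 0
    & forall i,
        let j := vj i in let k := vk i in let l := vl i in
        ((g i - g j) * (g k - g l)) / ((g j - g k) * (g l - g i))
          = (alpha i j / alpha i l)%:C
        /\ alpha i j / alpha i l < 0].

Definition admissible (alpha : vertex -> vertex -> R) (lam : R) : Prop :=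
  lam != 0 /\ forall i, 1 - lam * alpha i (vj i) != 0 /\
                        1 - lam * alpha i (vl i) != 0.

(* sqrtc is the principal root, so it is 'i times a positive real at a
   negative real argument. *)
Definition edge_mx (g : vertex -> R[i]) (alpha : vertex -> vertex -> R)
    (lam : R) (a b : vertex) : 'M[R[i]]_2 :=
  (sqrtc ((1 - lam * alpha a b)%:C))^-1 *:
    mx2 1 (diff g a b) ((lam * alpha a b)%:C / diff g a b) 1.

Definition weierstrass_frame (g : vertex -> R[i])
    (alpha : vertex -> vertex -> R) (lam : R) (E : vertex -> 'M[R[i]]_2) : Prop :=
  forall i, [/\ \det (E i) = 1,
    invmx (E i) *m E (vj i) = edge_mx g alpha lam i (vj i)
  & invmx (E i) *m E (vl i) = edge_mx g alpha lam i (vl i)].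

Definition calT (g : vertex -> R[i]) (i : vertex) : R := 1 - normc (g i) ^+ 2.

Definition L_mx (g : vertex -> R[i]) (i : vertex) : 'M[R[i]]_2 :=
  let s := sqrtc ((calT g i)%:C) in mx2 0 s (- s^-1) ((g i)^* / s).

Definition hat_n_mx (g : vertex -> R[i]) (E : vertex -> 'M[R[i]]_2)
    (i : vertex) : 'M[R[i]]_2 :=
  (Num.sg (calT g i))%:C *:
    (E i *m L_mx g i *m mx2 1 0 0 (-1) *m ctrmx (E i *m L_mx g i)).

Definition hat_n (g : vertex -> R[i]) (E : vertex -> 'M[R[i]]_2)
    (i : vertex) : 'rV[R]_4 := of_herm (hat_n_mx g E i).

Lemma hat_n_herm (g : vertex -> R[i]) (E : vertex -> 'M[R[i]]_2) i :
  to_herm (hat_n g E i) = hat_n_mx g E i.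
Proof.
apply: of_hermK; rewrite /hat_n_mx; set A := E i *m _; set D := mx2 _ _ _ _.
have ctM (M N : 'M[R[i]]_2) : ctrmx (M *m N) = ctrmx N *m ctrmx M.
  by rewrite /ctrmx map_mxM trmx_mul.
have ctK (M : 'M[R[i]]_2) : ctrmx (ctrmx M) = M.
  by apply/matrixP => p q; rewrite !mxE conjcK.
have ctD : ctrmx D = D.
  apply/matrixP; case=> -[|[|//]] lp; case=> -[|[|//]] lq;
  by rewrite !mxE /=; simpc.
have ctZ (r : R) (M : 'M[R[i]]_2) : ctrmx (r%:C *: M) = r%:C *: ctrmx M.
  by apply/matrixP => p q; rewrite !mxE rmorphM /= oppr0.
rewrite ctZ; move: A D ctD => A D ctD.
by rewrite !ctM ctK ctD mulmxA.
Qed.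

Definition singular_quad (n : vertex -> 'rV[R]_4) (i : vertex) : Prop :=
  let u := diff n i (vj i) in let v := diff n i (vl i) in
  mink u u * mink v v - mink u v ^+ 2 <= 0.

Definition calH (g : vertex -> R[i]) (alpha : vertex -> vertex -> R)
    (i : vertex) (lam : R) : R :=
  let j := vj i in let l := vl i in
  let h1 := (1 - normc (g j) ^+ 2) * normc (diff g i l) ^+ 2
              * (1 - lam * alpha i j) in
  let h2 := (1 - normc (g l) ^+ 2) * normc (diff g i j) ^+ 2
              * (1 - lam * alpha i l) in
  let h3 := (1 - normc (g i) ^+ 2) * normc (diff g j l) ^+ 2 in
  h1 ^+ 2 + h2 ^+ 2 + h3 ^+ 2
    - (h2 - h1) ^+ 2 - (h3 - h1) ^+ 2 - (h3 - h2) ^+ 2.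

Definition for_small_admissible (alpha : vertex -> vertex -> R)
    (P : R -> Prop) : Prop :=
  exists2 eps : R, 0 < eps &
    forall lam, admissible alpha lam -> 0 < `|lam| < eps -> P lam.

End Complex.

(* Main.v *)
Require Import Defs.
From mathcomp Require Import all_boot all_order all_algebra.
From mathcomp Require Import complex.
From mathcomp Require Import ring lra.
From mathcomp Require Import all_classical all_reals all_analysis.
Import Order.TTheory GRing.Theory Num.Theory.
Import numFieldNormedType.Exports.
Import ComplexField.Normc.
Local Open Scope ring_scope.
Local Open Scope complex_scope.

(** The proof reduces both properties to the sign of one real function.

    Let [u] and [v] be the two edges of the quadrilateral of [hat_n] at [i].
    Conjugation by the frame [E i] is a Lorentz transformation
    ([mink_congr]), so the Gram determinant of [u] and [v] may be computed
    from two explicit Hermitian matrices in which the frame no longer occurs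
    ([edge_congr]).  After a rescaling of the edges and up to a common
    factor, their scalar products are [2 h_1], [2 h_2] and
    [h_1 + h_2 - h_3], and the Gram determinant is a positive multiple of
    [calH lam] when [lam] is small and nonzero ([gram_hat_n]).  Hence the
    quadrilateral is singular if and only if [calH lam <= 0].

    At [lam = 0] only the three values [g_i], [g_j], [g_l] remain.  Write the
    circumcircle, be it a circle or a line, as
    [k |z|^2 - 2 Re (conj w * z) + m = 0].  It meets the unit circle
    transversally if and only if [(k + m)^2 < 4 |w|^2] ([intersect_unitP]),
    and [calH 0] is a positive multiple of [(k + m)^2 - 4 |w|^2] ([calH0]).
    So transversality is the strict inequality [calH 0 < 0].

    Finally [calH] is a quadratic polynomial in [lam].  If [calH 0 < 0], then
    [calH] stays negative near zero.  If [calH 0 >= 0], and the derivative at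
    zero does not vanish, then [calH] is positive on intervals arbitrarily
    close to zero ([quadratic_pos_itv]); as admissible parameters are dense
    ([admissible_dense]), some of them give nonsingular quadrilaterals. *)

(** * Two by two matrices and Minkowski space *)

Lemma ord2P (p : 'I_2) : p = 0 \/ p = 1.
Proof. by case: p => -[|[|//]] lp; [left|right]; apply/val_inj. Qed.

Lemma mx2P (R : realType) (A B : 'M[R[i]]_2) :
  A 0 0 = B 0 0 -> A 0 1 = B 0 1 -> A 1 0 = B 1 0 -> A 1 1 = B 1 1 -> A = B.
Proof.
move=> h00 h01 h10 h11; apply/matrixP => p q.
by case: (ord2P p) => ->; case: (ord2P q) => ->.
Qed.

Lemma mulmx2 (R : realType) (a b c d a' b' c' d' : R[i]) :
  mx2 a b c d *m mx2 a' b' c' d' =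
  mx2 (a * a' + b * c') (a * b' + b * d') (c * a' + d * c') (c * b' + d * d').
Proof. by apply: mx2P; rewrite !mxE !big_ord_recl big_ord0 !mxE /= addr0. Qed.

Lemma ctrmx2 (R : realType) (a b c d : R[i]) :
  ctrmx (mx2 a b c d) = mx2 a^* c^* b^* d^*.
Proof. by apply: mx2P; rewrite !mxE /=. Qed.

Lemma scalemx2 (R : realType) (k a b c d : R[i]) :
  k *: mx2 a b c d = mx2 (k * a) (k * b) (k * c) (k * d).
Proof. by apply: mx2P; rewrite !mxE /=. Qed.

Lemma submx2 (R : realType) (a b c d a' b' c' d' : R[i]) :
  mx2 a b c d - mx2 a' b' c' d' = mx2 (a - a') (b - b') (c - c') (d - d').
Proof. by apply: mx2P; rewrite !mxE /=. Qed.

Lemma ctrmxM (R : realType) (A B : 'M[R[i]]_2) :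
  ctrmx (A *m B) = ctrmx B *m ctrmx A.
Proof. by rewrite /ctrmx map_mxM trmx_mul. Qed.

Lemma ctrmxK (R : realType) (A : 'M[R[i]]_2) : ctrmx (ctrmx A) = A.
Proof. by apply/matrixP => p q; rewrite !mxE conjcK. Qed.

Lemma ctrmxD (R : realType) (A B : 'M[R[i]]_2) :
  ctrmx (A + B) = ctrmx A + ctrmx B.
Proof. by rewrite /ctrmx raddfD linearD. Qed.

Lemma det_ctrmx (R : realType) (A : 'M[R[i]]_2) : \det (ctrmx A) = (\det A)^*.
Proof. by rewrite /ctrmx det_tr det_map_mx. Qed.

Lemma of_hermD (R : realType) (X Y : 'M[R[i]]_2) :
  of_herm (X + Y) = of_herm X + of_herm Y.
Proof.
apply/rowP => q; rewrite !mxE.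
by case: q => -[|[|[|[|//]]]] lq /=; rewrite !raddfD //=; ring.
Qed.

Lemma of_hermB (R : realType) (X Y : 'M[R[i]]_2) :
  of_herm (X - Y) = of_herm X - of_herm Y.
Proof. by apply: (canRL (addrK _)); rewrite -of_hermD subrK. Qed.

Lemma mink_polar (R : realType) (x y : 'rV[R]_4) :
  mink x y = (mink (x + y) (x + y) - mink x x - mink y y) / 2.
Proof. by rewrite /mink !mxE; field. Qed.

Lemma mink_of_herm (R : realType) (X Y : 'M[R[i]]_2) :
  mink (of_herm X) (of_herm Y) =
    - (complex.Re (X 0 0) * complex.Re (Y 1 1) +
       complex.Re (X 1 1) * complex.Re (Y 0 0)) / 2
    + complex.Re (X 1 0) * complex.Re (Y 1 0)
    + complex.Im (X 1 0) * complex.Im (Y 1 0).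
Proof. by rewrite /mink !mxE /=; field. Qed.

(** [X |-> F X F^*] with [F] in [SL_2(C)] is a Lorentz transformation: it
    preserves the determinant, that is the quadratic form, hence also the
    bilinear form by polarization. *)
Lemma mink_congr (R : realType) (F X Y : 'M[R[i]]_2) :
  \det F = 1 -> ctrmx X = X -> ctrmx Y = Y ->
  mink (of_herm (F *m X *m ctrmx F)) (of_herm (F *m Y *m ctrmx F)) =
  mink (of_herm X) (of_herm Y).
Proof.
move=> detF hX hY.
have norm_congr (Z : 'M[R[i]]_2) : ctrmx Z = Z ->
  mink (of_herm (F *m Z *m ctrmx F)) (of_herm (F *m Z *m ctrmx F)) =
  mink (of_herm Z) (of_herm Z).
  move=> hZ; set m := mink _ _; set m' := mink _ _.
  suff: m%:C = m'%:C by case.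
  rewrite /m /m' !mink_det !of_hermK //; last by rewrite !ctrmxM ctrmxK hZ mulmxA.
  by rewrite !det_mulmx det_ctrmx detF conjc1 mul1r mulr1.
rewrite mink_polar -of_hermD -mulmxDl -mulmxDr !norm_congr //; last first.
  by rewrite ctrmxD hX hY.
by rewrite of_hermD -mink_polar.
Qed.

(** * The surface and its edges in the moving frame *)

Lemma sqr_normc_RI (R : realType) (z : R[i]) :
  normc z ^+ 2 = complex.Re z ^+ 2 + complex.Im z ^+ 2.
Proof. by case: z => x y; rewrite /= sqr_sqrtr // addr_ge0 // sqr_ge0. Qed.

(** The bar over [g] in [L_mx] stands under a division, hence denotes the
    conjugation of numerically closed fields rather than [conjc]. *)
Lemma conj_conjc {R : realType} (z : R[i]) : Num.conj z = conjc z.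
Proof. by []. Qed.

(** The normal [hat_n] seen in the frame [E]: a Hermitian matrix depending on
    the Gauss map alone. *)
Definition gauss_mx {R : realType} (g : vertex -> R[i]) (a : vertex) :=
  mx2 (- calT g a)%:C (- g a) (- conjc (g a)) 1.

(** With [s] the chosen square root of [T], one has [s * conjc s = `|T|] and
    [s ^+ 2 = T]; hence [s = sgn T * conjc s], and the sign in front of the
    product cancels the dependence on the branch of the root.  The same
    matrix is therefore obtained inside and outside the unit disc. *)
Lemma L_mx_congr (R : realType) (g : vertex -> R[i]) (a : vertex) :
  calT g a != 0 ->
  (Num.sg (calT g a))%:C *: (L_mx g a *m mx2 1 0 0 (-1) *m ctrmx (L_mx g a))
  = gauss_mx g a.
Proof.
move=> T0; rewrite /L_mx /gauss_mx conj_conjc.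
set s := sqrtc _; set t := conjc s.
set S := (Num.sg (calT g a))%:C.
have s2 : s ^+ 2 = (calT g a)%:C by rewrite sqr_sqrtc.
have s0 : s != 0 by rewrite sqrtc_eq0 eq_complex /= eqxx andbT.
have t0 : t != 0 by rewrite conjc_eq0.
have ss : s * t = (`|calT g a|)%:C.
  by rewrite -sqr_normc -normrX s2 normc_def /= expr0n addr0 sqrtr_sqr.
have S0 : S != 0 by rewrite eq_complex /= eqxx andbT sgr_eq0.
have S2 : S ^+ 2 = 1 by rewrite -rmorphXn /= sqr_sg T0.
have SV : S^-1 = S by apply: (mulfI S0); rewrite divff // -expr2 S2.
have TS : (calT g a)%:C = S * (`|calT g a|)%:C by rewrite -rmorphM /= -numEsg.
have sE : s = S * t.
  by apply: (mulIf s0); rewrite -mulrA [t * s]mulrC ss -TS -expr2.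
have sVE : s^-1 = S / t by rewrite {1}sE invfM SV.
have tT : t^-1 ^+ 2 * (calT g a)%:C = 1.
  have -> : (calT g a)%:C = t ^+ 2 by rewrite -s2 sE exprMn S2 mul1r.
  by rewrite exprVn mulVf // expf_neq0.
have gT : g a * conjc (g a) = 1 - (calT g a)%:C.
  rewrite /calT sqr_normc_RI; case: (g a) => x y; simpc => /=.
  by apply/eqP; rewrite eq_complex /=; apply/andP; split; apply/eqP; ring.
have cL : ctrmx (mx2 0 s (- s^-1) (conjc (g a) / s)) =
    mx2 0 (- t^-1) t (g a / t).
  rewrite ctrmx2; congr mx2; first exact: conjc0.
    by rewrite -conjc_inv; apply: rmorphN.
  transitivity (conjc (conjc (g a)) * conjc (s^-1)); first exact: rmorphM.
  by rewrite conjcK conjc_inv.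
rewrite cL !mulmx2 scalemx2.
have -> : (- calT g a)%:C = - (calT g a)%:C :> R[i] by apply: rmorphN.
have tt : t / t = 1 by rewrite divff.
set T := (calT g a)%:C in TS tT gT *; set M := (`|_|)%:C in ss TS.
clearbody s S t T M.
congr mx2.
- ring: ss TS.
- rewrite sE; ring: tt S2.
- rewrite sVE; ring: tt S2.
- rewrite sVE; ring: S2 gT tT.
Qed.

Lemma hat_n_mx_gauss (R : realType) (g : vertex -> R[i]) E a :
  calT g a != 0 ->
  hat_n_mx g E a = E a *m gauss_mx g a *m ctrmx (E a).
Proof.
move=> T0; rewrite -L_mx_congr // /hat_n_mx ctrmxM -scalemxAr -scalemxAl.
by rewrite !mulmxA.
Qed.

Lemma sum_sqr_neq0 {R : realType} {x y : R} :
  x +i* y != 0 -> x ^+ 2 + y ^+ 2 != 0.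
Proof.
by rewrite eq_complex /= paddr_eq0 ?sqr_ge0 // !sqrf_eq0.
Qed.

Lemma real_div {R : realType} (a x y : R) : x +i* y != 0 ->
  a%:C / (x +i* y) = (a * x / (x ^+ 2 + y ^+ 2)) +i* (- (a * y / (x ^+ 2 + y ^+ 2))).
Proof.
move=> p0; apply: (mulIf p0); rewrite mulfVK //; simpc.
have N0 := sum_sqr_neq0 p0.
apply/eqP; rewrite eq_complex /=; by apply/andP; split; apply/eqP; field.
Qed.

(** The edge [hat_n b - hat_n a] seen in the frame [E a], where
    [m = lam * alpha a b]. *)
Definition edge_diff {R : realType} (g : vertex -> R[i]) (a b : vertex)
    (m : R) : 'M[R[i]]_2 :=
  let p := Defs.diff g a b in let N := normc p ^+ 2 in
  (- (m / (1 - m)))%:C *: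
  mx2 (calT g a)%:C ((calT g a / N)%:C * p)
      ((calT g a / N)%:C * conjc p)
      ((calT g a - (1 - m) * calT g b) / N)%:C.

(** The frame at [b] is [E a *m U], so that [U] moves the normal at [b] into
    the frame at [a].  The entries simplify because
    [T_a - T_b = |p|^2 + 2 Re (conj g_a * p)] for [p = g_b - g_a]. *)
Lemma edge_congr (R : realType) (g : vertex -> R[i]) alpha lam a b :
  Defs.diff g a b != 0 -> 0 < 1 - lam * alpha a b ->
  let U := edge_mx g alpha lam a b in
  U *m gauss_mx g b *m ctrmx U - gauss_mx g a =
  edge_diff g a b (lam * alpha a b).
Proof.
move=> p0; rewrite /edge_mx /edge_diff /gauss_mx /calT !sqr_normc_RI.
move: (lam * alpha a b) => m; set p := Defs.diff g a b in p0 *.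
have -> : g b = g a + p by rewrite /p /Defs.diff addrC subrK.
move=> m1; rewrite sqrtc_sqrtr ?lecR ?ltW //=; case: (g a) p p0 => x y [p1 p2] p0 /=.
have m0 : 1 - m != 0 by rewrite gt_eqF.
have N0 := sum_sqr_neq0 p0.
rewrite real_div //.
set r := Num.sqrt _.
have r2 : r * r = 1 - m by rewrite -expr2 sqr_sqrtr // ltW.
have -> : (r%:C)^-1 = (r^-1)%:C :> R[i] by rewrite fmorphV.
rewrite !scalemx2 ctrmx2 !mulmx2 submx2.
simpc.
congr mx2; apply/eqP; rewrite eq_complex /=; apply/andP; split; apply/eqP.
all: have mE : m = 1 - r * r by rewrite r2 subKr.
all: have r0 : r != 0 by apply: contra_neq m0; rewrite -r2 => ->; rewrite mul0r.
all: by clearbody r; rewrite -?r2 ?mE; field; rewrite ?N0 ?r0.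
Qed.

Lemma normc_sqr_neq0 {R : realType} (z : R[i]) : z != 0 -> normc z ^+ 2 != 0.
Proof. by move=> z0; rewrite sqrf_eq0; apply: contra_neq z0 => /eq0_normc. Qed.

Lemma ctrmx_edge_diff (R : realType) (g : vertex -> R[i]) a b m :
  ctrmx (edge_diff g a b m) = edge_diff g a b m.
Proof.
rewrite /edge_diff; set p := Defs.diff g a b.
case: p => x y; rewrite scalemx2 ctrmx2; congr mx2; simpc => //.
Qed.

(** For a quadrilateral with [a = i], [b = j], [c = l] the bracket is
    [h_1 + h_2 - h_3]; for [b = c] and [m = n] its last term vanishes. *)
Lemma mink_edge_diff (R : realType) (g : vertex -> R[i]) a b c m n :
  Defs.diff g a b != 0 -> Defs.diff g a c != 0 -> 1 - m != 0 -> 1 - n != 0 ->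
  let N := normc (Defs.diff g a b) ^+ 2 in
  let M := normc (Defs.diff g a c) ^+ 2 in
  mink (of_herm (edge_diff g a b m)) (of_herm (edge_diff g a c n)) =
  calT g a * m * n / (2 * N * M * (1 - m) * (1 - n)) *
  (calT g b * M * (1 - m) + calT g c * N * (1 - n)
   - calT g a * normc (Defs.diff g b c) ^+ 2).
Proof.
move=> p0 q0 m0 n0 /=.
rewrite mink_of_herm /edge_diff !mxE /=.
have N0 := normc_sqr_neq0 _ p0; have M0 := normc_sqr_neq0 _ q0.
move: N0 M0; rewrite !sqr_normc_RI.
have -> : Defs.diff g b c = Defs.diff g a c - Defs.diff g a b.
  by rewrite /Defs.diff opprB addrA subrK.
rewrite /calT; case: (Defs.diff g a b) => p1 p2; case: (Defs.diff g a c) => q1 q2.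
move=> /= N0 M0.
by simpc => /=; field; rewrite N0 M0 m0 n0.
Qed.

Lemma diff_hat_n (R : realType) (g : vertex -> R[i]) alpha lam E a b :
  calT g a != 0 -> calT g b != 0 -> \det (E a) = 1 ->
  invmx (E a) *m E b = edge_mx g alpha lam a b ->
  Defs.diff g a b != 0 -> 0 < 1 - lam * alpha a b ->
  Defs.diff (hat_n g E) a b =
  of_herm (E a *m edge_diff g a b (lam * alpha a b) *m ctrmx (E a)).
Proof.
move=> Ta Tb detE EU p0 m1.
have Eunit : E a \in unitmx by rewrite unitmxE detE unitr1.
have Eb : E b = E a *m edge_mx g alpha lam a b by rewrite -EU mulKVmx.
rewrite /Defs.diff /hat_n -of_hermB !hat_n_mx_gauss // Eb -edge_congr //.
by rewrite mulmxBr mulmxBl ctrmxM !mulmxA.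
Qed.

(** * The Gram determinant of a quadrilateral *)

Lemma mink_diff_hat_n (R : realType) (g : vertex -> R[i]) alpha lam E a b c :
  (forall v, calT g v != 0) -> \det (E a) = 1 ->
  invmx (E a) *m E b = edge_mx g alpha lam a b ->
  invmx (E a) *m E c = edge_mx g alpha lam a c ->
  Defs.diff g a b != 0 -> Defs.diff g a c != 0 ->
  0 < 1 - lam * alpha a b -> 0 < 1 - lam * alpha a c ->
  let N := normc (Defs.diff g a b) ^+ 2 in
  let M := normc (Defs.diff g a c) ^+ 2 in
  let m := lam * alpha a b in
  let n := lam * alpha a c in
  mink (Defs.diff (hat_n g E) a b) (Defs.diff (hat_n g E) a c) =
  calT g a * m * n / (2 * N * M * (1 - m) * (1 - n)) *
  (calT g b * M * (1 - m) + calT g c * N * (1 - n)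
   - calT g a * normc (Defs.diff g b c) ^+ 2).
Proof.
move=> T0 detE Eb Ec p0 q0 m1 n1 N M m n.
rewrite (@diff_hat_n R g alpha lam E a b) //.
rewrite (@diff_hat_n R g alpha lam E a c) //.
rewrite (@mink_congr R (E a)) ?ctrmx_edge_diff //.
by rewrite mink_edge_diff // gt_eqF.
Qed.

(** Divide [u] by [m / (r (1 - m))] and [v] by [n / (r (1 - n))], where
    [r ^+ 2 = N * M].  Up to the common factor [T_i / 2], their scalar products
    become [2 h_1], [2 h_2] and [h_1 + h_2 - h_3], and
    [4 h_1 h_2 - (h_1 + h_2 - h_3)^2] is the Heron-type expression [calH]. *)
Lemma gram_hat_n (R : realType) (g : vertex -> R[i]) alpha lam E i :
  let j := vj i in let l := vl i in
  (forall v, calT g v != 0) -> \det (E i) = 1 ->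
  invmx (E i) *m E j = edge_mx g alpha lam i j ->
  invmx (E i) *m E l = edge_mx g alpha lam i l ->
  Defs.diff g i j != 0 -> Defs.diff g i l != 0 ->
  0 < 1 - lam * alpha i j -> 0 < 1 - lam * alpha i l ->
  let u := Defs.diff (hat_n g E) i j in let v := Defs.diff (hat_n g E) i l in
  let N := normc (Defs.diff g i j) ^+ 2 in
  let M := normc (Defs.diff g i l) ^+ 2 in
  let m := lam * alpha i j in let n := lam * alpha i l in
  mink u u * mink v v - mink u v ^+ 2 =
  (calT g i * m * n / (2 * N * M * (1 - m) * (1 - n))) ^+ 2
  * calH g alpha i lam.
Proof.
move=> j l T0 detE Ej El p0 q0 m1 n1 u v N M m n.
have diff0 w : normc (Defs.diff g w w) ^+ 2 = 0.
  by rewrite /Defs.diff subrr normc0 expr0n.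
have uu := mink_diff_hat_n _ _ _ _ _ _ _ _ T0 detE Ej Ej p0 p0 m1 m1.
have vv := mink_diff_hat_n _ _ _ _ _ _ _ _ T0 detE El El q0 q0 n1 n1.
have uv := mink_diff_hat_n _ _ _ _ _ _ _ _ T0 detE Ej El p0 q0 m1 n1.
have gramE (x y z x' y' z' : R) :
  x = x' -> y = y' -> z = z' -> x * y - z ^+ 2 = x' * y' - z' ^+ 2.
  by move=> -> -> ->.
rewrite /u /v (gramE _ _ _ _ _ _ uu vv uv) !diff0 /calH.
rewrite -/j -/l -/N -/M -/m -/n.
rewrite -![1 - normc _ ^+ 2]/(calT g _).
have N0 : N != 0 := normc_sqr_neq0 _ p0; have M0 : M != 0 := normc_sqr_neq0 _ q0.
have m0 : 1 - m != 0 by rewrite gt_eqF.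
have n0 : 1 - n != 0 by rewrite gt_eqF.
move: (calT g i) (calT g j) (calT g l) (normc _ ^+ 2) N M m n N0 M0 m0 n0
  => Ti Tj Tl P N' M' m' n' N0 M0 m0 n0.
by field; rewrite N0 M0 m0 n0.
Qed.

Lemma singular_quadP (R : realType) (g : vertex -> R[i]) alpha lam E i :
  let j := vj i in let l := vl i in
  (forall v, calT g v != 0) -> \det (E i) = 1 ->
  invmx (E i) *m E j = edge_mx g alpha lam i j ->
  invmx (E i) *m E l = edge_mx g alpha lam i l ->
  Defs.diff g i j != 0 -> Defs.diff g i l != 0 ->
  lam != 0 -> alpha i j != 0 -> alpha i l != 0 ->
  0 < 1 - lam * alpha i j -> 0 < 1 - lam * alpha i l ->
  singular_quad (hat_n g E) i <-> calH g alpha i lam <= 0.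
Proof.
move=> j l T0 detE Ej El p0 q0 lam0 a0 b0 m1 n1.
rewrite /singular_quad (@gram_hat_n R g alpha lam E i) //.
have m0 : 1 - lam * alpha i j != 0 by rewrite gt_eqF.
have n0 : 1 - lam * alpha i l != 0 by rewrite gt_eqF.
rewrite pmulr_rle0 // exprn_even_gt0 //= mulf_neq0 //.
  by rewrite !mulf_neq0.
have N0 := normc_sqr_neq0 _ p0; have M0 := normc_sqr_neq0 _ q0.
move: (normc (Defs.diff g i j) ^+ 2) (normc (Defs.diff g i l) ^+ 2) N0 M0.
by move=> N M N0 M0; rewrite invr_eq0 !mulf_eq0 !negb_or pnatr_eq0 N0 M0 m0 n0.
Qed.

(** * Circles, lines and the unit circle *)

(** Circles and lines share the equation
    [k |z|^2 - 2 Re (conj w * z) + m = 0]; the next three functions give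
    [k], [w] and [m].  A line is normalized by [w = 'i * v]. *)
Definition gc_lead {R : realType} (C : gcircle R) : R :=
  match C with Circle _ _ => 1 | Line _ _ => 0 end.
Definition gc_normal {R : realType} (C : gcircle R) : R[i] :=
  match C with Circle c _ => c | Line _ v => (- complex.Im v) +i* complex.Re v end.
Definition gc_const {R : realType} (C : gcircle R) : R :=
  match C with
  | Circle c r => normc c ^+ 2 - r ^+ 2
  | Line p v => 2 * (complex.Re v * complex.Im p - complex.Im v * complex.Re p)
  end.

Lemma on_gcircleP (R : realType) (C : gcircle R) (z : R[i]) : gcircle_wf C ->
  on_gcircle C z <->
  gc_lead C * normc z ^+ 2
  - 2 * (complex.Re (gc_normal C) * complex.Re z
         + complex.Im (gc_normal C) * complex.Im z) + gc_const C = 0.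
Proof.
rewrite !sqr_normc_RI.
case: C => [[c1 c2] r | [p1 p2] [v1 v2]]; case: z => x y.
  rewrite /gcircle_wf /gc_const sqr_normc_RI /= => r0.
  have eqE : (x - c1) ^+ 2 + (y - c2) ^+ 2 = r ^+ 2 <->
     1 * (x ^+ 2 + y ^+ 2) - 2 * (c1 * x + c2 * y)
     + (c1 ^+ 2 + c2 ^+ 2 - r ^+ 2) = 0.
    by split=> h; nra.
  rewrite -eqE; split => [<- | h].
    by rewrite sqr_sqrtr // addr_ge0 ?sqr_ge0.
  by rewrite h sqrtr_sqr ger0_norm // ltW.
rewrite /gcircle_wf => v0; have n0 := sum_sqr_neq0 v0.
rewrite /= mul0r; split.
  by case=> t []; simpc => -> ->; ring.
move=> h; exists ((v1 * (x - p1) + v2 * (y - p2)) / (v1 ^+ 2 + v2 ^+ 2)).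
have k : v1 * (y - p2) = v2 * (x - p1) by lra.
apply/eqP; rewrite eq_complex; simpc => /=; apply/andP; split; apply/eqP.
  have kx := congr1 ( *%R v2) k.
  by apply: (mulIf n0); rewrite mulrDl -[_ / _ * _]mulrAC mulfVK //; lra.
have ky := congr1 ( *%R v1) k.
by apply: (mulIf n0); rewrite mulrDl -[_ / _ * _]mulrAC mulfVK //; lra.
Qed.

(** The gradient of the common equation is [2 (k z - w)], and the tangent is
    obtained from it by a quarter turn. *)
Lemma tangent_dirE (R : realType) (C : gcircle R) (z : R[i]) :
  tangent_dir C z = 'i%C * ((gc_lead C)%:C * z - gc_normal C).
Proof.
case: C => [c r | p [v1 v2]] /=; rewrite -?complexiE ?mul1r //.
by rewrite mul0r sub0r; simpc.
Qed.

(** On the unit circle the equation of [C] becomes the linear condition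
    [2 Re (conj w * z) = k + m]; the expression below is negative exactly when
    this line crosses the unit circle at two points. *)
Definition unit_discr {R : realType} (C : gcircle R) : R :=
  (gc_lead C + gc_const C) ^+ 2 - 4 * normc (gc_normal C) ^+ 2.

(** At a common point [z], the square of the cross product of [w] and [z] is
    [|w|^2 - (k + m)^2 / 4], and the two tangents are independent exactly
    when this cross product is nonzero.  Conversely, a negative discriminant
    leaves room for a common point, obtained by solving the linear condition
    along [w] and adding a suitable multiple of the normal to [w]. *)
Lemma intersect_unitP (R : realType) (C : gcircle R) : gcircle_wf C ->
  intersect_transversally C (unit_circle R) <-> unit_discr C < 0.
Proof.
move=> wfC; rewrite /unit_discr sqr_normc_RI.
have onU (x y : R) : on_gcircle (unit_circle R) (x +i* y) <->
    x ^+ 2 + y ^+ 2 = 1.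
  rewrite on_gcircleP ?ltr01 //= sqr_sqrtr ?addr_ge0 ?sqr_ge0 //.
  by rewrite !expr0n /= addr0 sqrtr0 expr0n /=; split=> h; lra.
have onC (x y : R) := on_gcircleP R C (x +i* y) wfC.
have tC (z : R[i]) := tangent_dirE R C z.
have tU (z : R[i]) : tangent_dir (unit_circle R) z = 'i%C * z.
  by rewrite tangent_dirE /= mul1r subr0.
move: (gc_lead C) (gc_const C) (gc_normal C) onC tC => k m [w1 w2] /= onC tC.
have discE x y : x ^+ 2 + y ^+ 2 = 1 ->
    k * (x ^+ 2 + y ^+ 2) - 2 * (w1 * x + w2 * y) + m = 0 ->
    (k + m) ^+ 2 - 4 * (w1 ^+ 2 + w2 ^+ 2) = - (4 * (w1 * y - w2 * x) ^+ 2).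
  move=> n1; rewrite n1 mulr1 => zC.
  have -> : k + m = 2 * (w1 * x + w2 * y) by lra.
  have -> : w1 ^+ 2 + w2 ^+ 2 = (w1 ^+ 2 + w2 ^+ 2) * (x ^+ 2 + y ^+ 2).
    by rewrite n1 mulr1.
  by ring.
split.
- case=> -[[x y] [/onC]]; rewrite sqr_sqrtr ?addr_ge0 ?sqr_ge0 //.
  move=> zC zU ind; move: (zU) => /onU n1.
  have {}ind := ind (x +i* y) ((onC x y).2 _) zU; rewrite tC tU in ind.
  rewrite sqr_sqrtr ?addr_ge0 ?sqr_ge0 // in ind; have {}ind := ind zC.
  rewrite (discE x y) //.
  rewrite oppr_lt0 pmulr_rgt0 ?ltr0n // exprn_even_gt0 //=.
  apply/eqP => D0.
  (* If the cross product vanishes, then [w] is its projection on [z]. *)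
  case: (ind 1 (w1 * x + w2 * y - k)); last by move/eqP; rewrite oner_eq0.
  have xE : w1 = (w1 * x + w2 * y) * x.
    transitivity (w1 * (x ^+ 2 + y ^+ 2)); first by rewrite n1 mulr1.
    by have := congr1 ( *%R y) D0; lra.
  have yE : w2 = (w1 * x + w2 * y) * y.
    transitivity (w2 * (x ^+ 2 + y ^+ 2)); first by rewrite n1 mulr1.
    by have := congr1 ( *%R x) D0; lra.
  by simpc; apply/eqP; rewrite eq_complex /=; apply/andP; split; apply/eqP; lra.
- move=> disc; split.
    have n0 : 0 < w1 ^+ 2 + w2 ^+ 2.
      by have := sqr_ge0 (k + m); lra.
    set s := (k + m) / 2; set D := Num.sqrt (w1 ^+ 2 + w2 ^+ 2 - s ^+ 2).
    have D2 : D ^+ 2 = w1 ^+ 2 + w2 ^+ 2 - s ^+ 2.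
      by rewrite sqr_sqrtr // /s expr_div_n; lra.
    have nn : w1 ^+ 2 + w2 ^+ 2 != 0 by rewrite gt_eqF.
    pose x := (s * w1 - D * w2) / (w1 ^+ 2 + w2 ^+ 2).
    pose y := (s * w2 + D * w1) / (w1 ^+ 2 + w2 ^+ 2).
    have xy1 : x ^+ 2 + y ^+ 2 = 1.
      transitivity ((s ^+ 2 + D ^+ 2) / (w1 ^+ 2 + w2 ^+ 2)).
        by rewrite /x /y; field.
      by rewrite D2; field.
    exists (x +i* y); split; last by apply/onU.
    apply/onC; rewrite sqr_sqrtr ?addr_ge0 ?sqr_ge0 // xy1.
    have -> : w1 * x + w2 * y = s by rewrite /x /y; field.
    by rewrite /s; field.
  case=> x y /onC; rewrite sqr_sqrtr ?addr_ge0 ?sqr_ge0 // => zC /onU n1.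
  rewrite tC tU => a b.
  have D0 : w1 * y - w2 * x != 0.
    apply/eqP => D0; move: disc; rewrite (discE x y) //.
    by rewrite D0 expr0n mulr0 oppr0 ltxx.
  simpc => -[h1 h2].
  have a0 : a = 0.
    apply: (mulIf D0); rewrite mul0r.
    have := congr1 ( *%R x) h1; have := congr1 ( *%R y) h2.
    by lra.
  split=> //; move: h1 h2; rewrite a0 => h1 h2.
  transitivity (b * (x ^+ 2 + y ^+ 2)); first by rewrite n1 mulr1.
  have := congr1 ( *%R y) h1; have := congr1 ( *%R x) h2.
  by lra.
Qed.

(** * The value at zero and the circumcircle *)

(** At [lam = 0], [calH] is already a discriminant of the same shape as
    [unit_discr].  Here [(x, y)] is [g_i], [p] and [q] are the edges at [g_i],
    and [d], [d (x, y) + (e1, e2)] are up to a factor the coefficients [k] and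
    [w] of the circle through the three points, solved by Cramer's rule.  As
    no division occurs, the identity persists in the collinear case. *)
Lemma calH0_square (R : realType) (x y p1 p2 q1 q2 : R) :
  let T a b := 1 - (a ^+ 2 + b ^+ 2) in
  let N := p1 ^+ 2 + p2 ^+ 2 in let M := q1 ^+ 2 + q2 ^+ 2 in
  let h1 := T (x + p1) (y + p2) * M in
  let h2 := T (x + q1) (y + q2) * N in
  let h3 := T x y * ((q1 - p1) ^+ 2 + (q2 - p2) ^+ 2) in
  let d := 2 * (p1 * q2 - p2 * q1) in
  let e1 := N * q2 - M * p2 in let e2 := M * p1 - N * q1 in
  h1 ^+ 2 + h2 ^+ 2 + h3 ^+ 2 - (h2 - h1) ^+ 2 - (h3 - h1) ^+ 2 - (h3 - h2) ^+ 2
  = (d * (1 + (x ^+ 2 + y ^+ 2)) + 2 * (x * e1 + y * e2)) ^+ 2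
    - 4 * ((d * x + e1) ^+ 2 + (d * y + e2) ^+ 2).
Proof. by rewrite /=; ring. Qed.

(** Three distinct points determine the equation of [C] up to a factor, so the
    coefficients solved by Cramer's rule are a nonzero multiple of those of
    [C]. *)
Lemma gcircle_through3 (R : realType) (C : gcircle R) (x y p1 p2 q1 q2 : R) :
  gcircle_wf C -> on_gcircle C (x +i* y) ->
  on_gcircle C ((x + p1) +i* (y + p2)) ->
  on_gcircle C ((x + q1) +i* (y + q2)) ->
  p1 +i* p2 != 0 -> q1 +i* q2 != 0 -> p1 +i* p2 != q1 +i* q2 ->
  let N := p1 ^+ 2 + p2 ^+ 2 in let M := q1 ^+ 2 + q2 ^+ 2 in
  let d := 2 * (p1 * q2 - p2 * q1) in
  let e1 := N * q2 - M * p2 in let e2 := M * p1 - N * q1 in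
  exists2 mu : R, mu != 0 &
  [/\ d * (1 + (x ^+ 2 + y ^+ 2)) + 2 * (x * e1 + y * e2)
       = mu * (gc_lead C + gc_const C),
      d * x + e1 = mu * complex.Re (gc_normal C) &
      d * y + e2 = mu * complex.Im (gc_normal C)].
Proof.
move=> wfC; rewrite !on_gcircleP // !sqr_normc_RI /= => oi oj ol p0 q0 pq.
have N0 := sum_sqr_neq0 p0; have M0 := sum_sqr_neq0 q0.
case: C wfC oi oj ol => [[c1 c2] r | [a1 a2] [v1 v2]] wfC /=.
  rewrite sqr_sqrtr ?addr_ge0 ?sqr_ge0 // => oi oj ol.
  have jE : p1 ^+ 2 + p2 ^+ 2 = 2 * ((c1 - x) * p1 + (c2 - y) * p2) by lra.
  have lE : q1 ^+ 2 + q2 ^+ 2 = 2 * ((c1 - x) * q1 + (c2 - y) * q2) by lra.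
  exists (2 * (p1 * q2 - p2 * q1)).
    rewrite mulf_neq0 ?pnatr_eq0 //; apply/eqP => d0.
    have e1 : (p1 ^+ 2 + p2 ^+ 2) * q2 = (q1 ^+ 2 + q2 ^+ 2) * p2.
      by rewrite jE lE; have := congr1 ( *%R (c1 - x)) d0; lra.
    have e2 : (p1 ^+ 2 + p2 ^+ 2) * q1 = (q1 ^+ 2 + q2 ^+ 2) * p1.
      by rewrite jE lE; have := congr1 ( *%R (c2 - y)) d0; lra.
    have NM : p1 ^+ 2 + p2 ^+ 2 = q1 ^+ 2 + q2 ^+ 2.
      apply: (mulfI (mulf_neq0 N0 M0)).
      transitivity (((p1 ^+ 2 + p2 ^+ 2) * q1) ^+ 2
                    + ((p1 ^+ 2 + p2 ^+ 2) * q2) ^+ 2); first by ring.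
      by rewrite e1 e2; ring.
    move: pq; rewrite -NM in e1 e2.
    by rewrite (mulfI N0 e1) (mulfI N0 e2) eqxx.
  have cE : c1 ^+ 2 + c2 ^+ 2 - r ^+ 2 = 2 * (c1 * x + c2 * y) - (x ^+ 2 + y ^+ 2).
    by lra.
  by split; rewrite jE lE ?cE; ring.
move=> oi oj ol.
have n0 := sum_sqr_neq0 wfC.
have dirE (a b : R) : v1 * b = v2 * a ->
    exists t, a = t * v1 /\ b = t * v2.
  move=> k; exists ((v1 * a + v2 * b) / (v1 ^+ 2 + v2 ^+ 2)).
  have ka := congr1 ( *%R v2) k; have kb := congr1 ( *%R v1) k.
  by split; apply: (mulIf n0); rewrite -[_ / _ * _]mulrAC mulfVK //; lra.
have [|t [p1E p2E]] := dirE p1 p2; first by lra.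
have [|u [q1E q2E]] := dirE q1 q2; first by lra.
move: p0 q0 pq; rewrite p1E p2E q1E q2E => p0 q0 pq.
have t0 : t != 0 by apply: contra_neq p0 => ->; rewrite !mul0r.
have u0 : u != 0 by apply: contra_neq q0 => ->; rewrite !mul0r.
have tu : t - u != 0.
  by rewrite subr_eq0; apply: contra_neq pq => ->.
exists (- (t * u * (t - u) * (v1 ^+ 2 + v2 ^+ 2))).
  by rewrite oppr_eq0 !mulf_eq0 !negb_or t0 u0 tu n0.
have aE : 2 * (v1 * a2 - v2 * a1) = 2 * (v1 * y - v2 * x) by lra.
by rewrite aE; split; ring.
Qed.

(** The two coefficient vectors agree up to the factor [mu] of
    [gcircle_through3], whose sign is lost in the square. *)
Lemma calH0 (R : realType) (C : gcircle R) (g : vertex -> R[i]) alpha i :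
  gcircle_wf C -> on_gcircle C (g i) -> on_gcircle C (g (vj i)) ->
  on_gcircle C (g (vl i)) ->
  Defs.diff g i (vj i) != 0 -> Defs.diff g i (vl i) != 0 ->
  g (vj i) != g (vl i) ->
  exists2 mu : R, mu != 0 & calH g alpha i 0 = mu ^+ 2 * unit_discr C.
Proof.
move=> wfC oi oj ol p0 q0 pq.
have jE : g (vj i) = g i + Defs.diff g i (vj i) by rewrite /Defs.diff addrC subrK.
have lE : g (vl i) = g i + Defs.diff g i (vl i) by rewrite /Defs.diff addrC subrK.
have jlE : Defs.diff g (vj i) (vl i) =
  Defs.diff g i (vl i) - Defs.diff g i (vj i).
  by rewrite /Defs.diff opprB addrA subrK.
rewrite /calH /unit_discr jlE jE lE; rewrite jE lE (inj_eq (addrI _)) in oj ol pq.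
move: (g i) (Defs.diff g i (vj i)) (Defs.diff g i (vl i)) oi oj ol p0 q0 pq.
move=> [x y] [p1 p2] [q1 q2] oi oj ol p0 q0 pq.
have [mu mu0 [X Y1 Y2]] := gcircle_through3 _ _ _ _ _ _ _ _ wfC oi oj ol p0 q0 pq.
exists mu => //.
rewrite !mul0r !subr0 !mulr1 !sqr_normc_RI /= calH0_square X Y1 Y2; ring.
Qed.

(** * Small admissible parameters *)

(** Admissibility involves the edges of the whole lattice, so it may fail for
    parameters arbitrarily close to zero; but the excluded parameters form a
    countable set, which cannot contain an interval. *)
Lemma admissible_dense (R : realType) (alpha : vertex -> vertex -> R) (a b : R) :
  a < b -> exists2 lam, a < lam < b & admissible alpha lam.
Proof.
move=> ab.
pose excluded (e : option (vertex * bool)) : R :=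
  match e with
  | None => 0
  | Some (v, h) => if h then (alpha v (vj v))^-1 else (alpha v (vl v))^-1
  end.
have cexcluded : countable (range excluded)%classic.
  exact: sub_countable (card_image_le _ _) (countableP _).
apply: contrapT => none.
have sub : (`]a, b[ `<=` range excluded)%classic.
  move=> lam /=; rewrite in_itv /= => lamab.
  apply: contrapT => nexcluded; apply: none; exists lam => //.
  split; first by apply/eqP => lam0; apply: nexcluded; exists None.
  have inv_excluded (x : R) : 1 - lam * x = 0 -> x^-1 = lam.
    move=> /eqP; rewrite subr_eq0 => /eqP lx.
    have x0 : x != 0.
      by apply/eqP => x0; move/eqP: lx; rewrite x0 mulr0 oner_eq0.
    by apply: (mulIf x0); rewrite mulVf.
  by move=> v; split; apply/eqP => /inv_excluded h; apply: nexcluded;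
    [exists (Some (v, true)) | exists (Some (v, false))].
have cab : countable (`]a, b[%classic : set R).
  by apply: sub_countable cexcluded; apply: subset_card_le.
have := countable_lebesgue_measure0 cab.
rewrite lebesgue_measure_itv /= lte_fin ab -EFinB => -[] /eqP.
by rewrite subr_eq0 gt_eqF.
Qed.

(** A quotient which is negative is in particular nonzero, so neither value of
    [alpha] vanishes.  Were [g_j = g_l], the cross ratio would be [1]. *)
Lemma cross_ratio_facts (R : realType) (g : vertex -> R[i]) alpha i :
  discrete_holomorphic g alpha ->
  [/\ alpha i (vj i) != 0, alpha i (vl i) != 0 & g (vj i) != g (vl i)].
Proof.
case=> _ _ /(_ i) /= [cr neg].
have neq0 : alpha i (vj i) / alpha i (vl i) != 0 by rewrite lt_eqF.
move: (neq0); rewrite mulf_eq0 invr_eq0 negb_or => /andP[-> ->]; split=> //.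
apply/eqP => jl; move: cr; rewrite -jl.
have -> : (g (vj i) - g (vk i)) * (g (vj i) - g i) =
          (g i - g (vj i)) * (g (vk i) - g (vj i)) by ring.
have [-> | N0] := eqVneq ((g i - g (vj i)) * (g (vk i) - g (vj i))) 0.
  by rewrite mul0r => -[] /esym /eqP; rewrite (negPf neq0).
rewrite divff // => -[] h; move: neg; rewrite -h.
by rewrite ltr10.
Qed.

Lemma calH_poly (R : realType) (g : vertex -> R[i]) alpha i :
  exists H1 H2, forall lam,
    calH g alpha i lam = calH g alpha i 0 + H1 * lam + H2 * lam ^+ 2.
Proof.
rewrite /calH.
pose A := (1 - normc (g (vj i)) ^+ 2) * normc (Defs.diff g i (vl i)) ^+ 2.
pose B := (1 - normc (g (vl i)) ^+ 2) * normc (Defs.diff g i (vj i)) ^+ 2.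
pose D := (1 - normc (g i) ^+ 2) * normc (Defs.diff g (vj i) (vl i)) ^+ 2.
pose x := alpha i (vj i); pose y := alpha i (vl i).
exists (- 2 * A * B * (x + y) - 2 * D * (A * x + B * y) + 2 * A ^+ 2 * x + 2 * B ^+ 2 * y).
exists (2 * A * B * x * y - A ^+ 2 * x ^+ 2 - B ^+ 2 * y ^+ 2).
move=> lam; rewrite -/A -/B -/D -/x -/y; ring.
Qed.

Lemma quadratic_pos_near0 (R : realType) (c0 c1 c2 : R) : 0 < c0 ->
  exists2 e : R, 0 < e &
    forall x, `|x| < e -> 0 < c0 + c1 * x + c2 * x ^+ 2.
Proof.
move=> c0_gt0; set K := `|c1| + `|c2| + 1.
have K0 : 0 < K by rewrite /K; have := normr_ge0 c1; have := normr_ge0 c2; lra.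
exists (Num.min 1 (c0 / K)); first by rewrite lt_min ltr01 divr_gt0.
move=> x; rewrite lt_min ltr_pdivlMr // => /andP[x1 xK].
have x2 : `|x| ^+ 2 <= `|x|.
  by rewrite expr2 ler_piMl // ltW.
have h : `|c1 * x + c2 * x ^+ 2| <= `|x| * K.
  apply: (le_trans (ler_normD _ _)); rewrite !normrM.
  have := ler_wpM2l (normr_ge0 c2) x2; have := normr_ge0 x.
  by rewrite /K; lra.
have := le_lt_trans h xK; rewrite ltr_norml => /andP[].
lra.
Qed.

(** The interval lies on the side of zero selected by the sign of [c1] when
    [c0 = 0]; this is where the nonvanishing of the derivative of [calH] is
    needed. *)
Lemma quadratic_pos_itv (R : realType) (c0 c1 c2 e : R) :
  0 <= c0 -> (c0 = 0 -> c1 != 0) -> 0 < e ->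
  exists a b, a < b /\ forall x, a < x < b ->
    0 < `|x| < e /\ 0 < c0 + c1 * x + c2 * x ^+ 2.
Proof.
rewrite le_eqVlt => /orP[/eqP <- /(_ erefl) c1_neq0 | c0_gt0 _] e_gt0; last first.
  have [d d_gt0 hd] := quadratic_pos_near0 _ _ c1 c2 c0_gt0.
  exists 0, (Num.min e d); split; first by rewrite lt_min e_gt0.
  move=> x /andP[x0]; rewrite lt_min => /andP[xe xd].
  by rewrite gtr0_norm // x0 xe; split=> //; apply: hd; rewrite gtr0_norm.
have [c1_gt0 | c1_lt0 | /eqP] := ltgtP 0 c1; last by rewrite eq_sym (negPf c1_neq0).
  have [d d_gt0 hd] := quadratic_pos_near0 _ _ c2 0 c1_gt0.
  exists 0, (Num.min e d); split; first by rewrite lt_min e_gt0.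
  move=> x /andP[x0]; rewrite lt_min => /andP[xe xd].
  rewrite gtr0_norm // x0 xe; split=> //.
  have -> : 0 + c1 * x + c2 * x ^+ 2 = x * (c1 + c2 * x + 0 * x ^+ 2) by ring.
  by rewrite mulr_gt0 // hd // gtr0_norm.
have c1N : 0 < - c1 by rewrite oppr_gt0.
have [d d_gt0 hd] := quadratic_pos_near0 _ _ (- c2) 0 c1N.
exists (- Num.min e d), 0; split; first by rewrite oppr_lt0 lt_min e_gt0.
move=> x /andP[]; rewrite ltrNl lt_min => /andP[xe xd] x0.
rewrite ltr0_norm // oppr_gt0 x0 xe; split=> //.
have -> : 0 + c1 * x + c2 * x ^+ 2 = - x * (- c1 + - c2 * x + 0 * x ^+ 2) by ring.
by rewrite mulr_gt0 ?oppr_gt0 // hd // ltr0_norm.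
Qed.

Lemma derive1_quadratic0 (R : realType) (c0 c1 c2 : R) :
  derive1 (fun x : R => c0 + c1 * x + c2 * x ^+ 2) 0 = c1.
Proof.
rewrite derive1E.
have h : is_derive (0 : R) (1 : R) (fun x : R => c0 + c1 * x + c2 * x ^+ 2) c1.
  apply: is_derive_eq.
  by rewrite !(scale0r, scaler0, addr0, add0r, mul1r); apply: mulr1.
by rewrite derive_val.
Qed.

(** * Singular quadrilaterals and transversality *)

Theorem theorem9p1 (R : realType) (g : vertex -> R[i])
    (alpha : vertex -> vertex -> R)
    (hg : discrete_holomorphic g alpha)
    (hT : forall a : vertex, normc (g a) != 1)
    (E : R -> vertex -> 'M[R[i]]_2)
    (hE : forall lam : R, admissible alpha lam ->
            weierstrass_frame g alpha lam (E lam))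
    (i : vertex) (C : gcircle R) (hC : is_circumcircle C g i) :
  (intersect_transversally C (unit_circle R) ->
     for_small_admissible alpha
       (fun lam => singular_quad (hat_n g (E lam)) i))
  /\
  (derive1 (calH g alpha i) 0 <> 0 ->
     for_small_admissible alpha
       (fun lam => singular_quad (hat_n g (E lam)) i) ->
     intersect_transversally C (unit_circle R)).
Proof.
have T0 v : calT g v != 0.
  rewrite /calT subr_eq0 eq_sym; apply: contraNneq (hT v) => /eqP.
  rewrite sqrf_eq1 => /orP[// | /eqP n1].
  have : 0 <= normc (g v) by case: (g v) => x y /=; apply: sqrtr_ge0.
  by rewrite n1 oppr_ge0 ler10.
have [p0 q0] : Defs.diff g i (vj i) != 0 /\ Defs.diff g i (vl i) != 0.
  by case: hg => _ /(_ i).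
have [a0 b0 jl] := cross_ratio_facts _ _ _ i hg.
case: hC => wfC oi oj _ ol.
have [mu mu0 H0E] := calH0 _ _ _ alpha _ wfC oi oj ol p0 q0 jl.
have mu2 : 0 < mu ^+ 2 by rewrite exprn_even_gt0.
have [H1 [H2 HE]] := calH_poly _ g alpha i.
have [e e0 singE] : exists2 e : R, 0 < e & forall lam, admissible alpha lam ->
    `|lam| < e -> singular_quad (hat_n g (E lam)) i <-> calH g alpha i lam <= 0.
  (* Near zero the radicands of the two edges at [i] are positive. *)
  have [ea ea0 ha] := quadratic_pos_near0 _ _ (- alpha i (vj i)) 0 ltr01.
  have [eb eb0 hb] := quadratic_pos_near0 _ _ (- alpha i (vl i)) 0 ltr01.
  exists (Num.min ea eb); first by rewrite lt_min ea0.
  move=> lam adm; rewrite lt_min => /andP[lea leb].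
  have [detE Ej El] := hE lam adm i; case: (adm) => lam0 _.
  apply: (singular_quadP _ _ _ _ _ _ T0 detE Ej El) => //.
    by have := ha _ lea; lra.
  by have := hb _ leb; lra.
rewrite intersect_unitP //; split.
  move=> disc; have [|d d0 hd] := quadratic_pos_near0 _ (- calH g alpha i 0) (- H1) (- H2).
    by rewrite oppr_gt0 H0E pmulr_rlt0.
  exists (Num.min e d); first by rewrite lt_min e0.
  move=> lam adm /andP[_]; rewrite lt_min => /andP[le ld].
  by apply/singE => //; rewrite HE; have := hd _ ld; lra.
move=> dH [eps eps0 sing]; rewrite ltNge; apply/negP => disc.
have H0_ge0 : 0 <= calH g alpha i 0 by rewrite H0E pmulr_rge0.
(* Otherwise [calH] is positive on an interval arbitrarily close to zero, and
   this interval contains an admissible parameter. *)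
have [||u [v [uv pos]]] :=
  @quadratic_pos_itv R (calH g alpha i 0) H1 H2 (Num.min e eps) H0_ge0.
- move=> _; apply/eqP => H10; apply: dH.
  by rewrite (funext HE) derive1_quadratic0.
- by rewrite lt_min e0.
have [lam /pos[/andP[lam0]]] := admissible_dense _ alpha _ _ uv.
rewrite lt_min => /andP[le leps] + adm; rewrite -HE ltNge.
by move/negP; apply; apply/singE => //; apply: sing => //; rewrite lam0.
Qed.
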